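(* Let $\mu$ be a permuton and $\sigma_n\sim\mathrm{Sample}_n(\mu)$ for each $n\in\mathbb{N}^*$. Then for any $\beta\in\big(0,\widetilde{\mathrm{LIS}}_1(\mu)\big)$: $$\limsup_{n\to\infty}\frac1n\log\mathbf{P}\big(\mathrm{LIS}(\sigma_n)<\beta n\big)\ \le\ -\sup_{j\ge1,\ j\beta<\widetilde{\mathrm{LIS}}_j(\mu)}\Lambda^*_{\widetilde{\mathrm{LIS}}_j(\mu)}(j\beta),$$ where the supremum is over integers $j\ge 1$ with $j\beta<\widetilde{\mathrm{LIS}}_j(\mu)$.
   Context: $\mathbb{N}^*=\{1,2,\dots\}$. A permuton is a Borel probability measure on $[0,1]^2$ with both marginals uniform on $[0,1]$. Given points $Z_1,\dots,Z_n\in[0,1]^2$ with distinct $x$-coordinates and distinct $y$-coordinates, $\mathrm{Perm}(Z_1,\dots,Z_n)$ is the permutation $\sigma$ of $\{1,\dots,n\}$ with $\sigma(i)=j$ whenever the point with $i$-th lowest $x$-coordinate has $j$-th lowest $y$-coordinate. $\mathrm{Sample}_n(\mu)$ is the law of $\mathrm{Perm}(Z_1,\dots,Z_n)$ for $Z_1,\dots,Z_n$ i.i.d. with law $\mu$ (a.s. well defined). $\mathrm{LIS}(\sigma)$ is the maximal length of an increasing subsequence of the permutation $\sigma$. A subset $A\subset[0,1]^2$ is nondecreasing if $(x_2-x_1)(y_2-y_1)\ge 0$ for all $(x_1,y_1),(x_2,y_2)\in A$, and $j$-nondecreasing if it is a union of $j$ nondecreasing subsets. $\widetilde{\mathrm{LIS}}_j(\mu):=\sup_A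 \mu(A)$ over closed $j$-nondecreasing $A\subset[0,1]^2$. For $p,q\in[0,1]$, $\Lambda_p^*(q):=q\log\frac qp+(1-q)\log\frac{1-q}{1-p}\in[0,+\infty]$, with the usual conventions ($0\log\frac{0}{\cdot}=0$, $a\log\frac a0=+\infty$ for $a>0$). Also $\log0=-\infty$. *)

(* Defs.v *)
From HB Require Import structures.
From mathcomp Require Import all_boot all_order all_algebra all_fingroup.
From mathcomp Require Import all_classical all_reals all_analysis.
Import Order.TTheory GRing.Theory Num.Theory.
Import numFieldNormedType.Exports.

Set Implicit Arguments.
Unset Strict Implicit.
Unset Printing Implicit Defensive.

Local Open Scope classical_set_scope.
Local Open Scope ring_scope.

Definition plane (R : realType) := (measurableTypeR R * measurableTypeR R)%type.

Definition unit_square (R : realType) : set (R * R) := `[0, 1] `*` `[0, 1].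
Arguments unit_square : clear implicits.

(* Borel measures on [0,1]^2 are represented as Borel measures on R^2 that give
   full mass to [0,1]^2. *)
Definition permuton (R : realType) (mu : probability (plane R) R) : Prop :=
  [/\ mu (unit_square R) = 1%E,
      forall A : set (measurableTypeR R), measurable A ->
        mu (fst @^-1` A) = uniform_prob (@ltr01 R) A
    & forall A : set (measurableTypeR R), measurable A ->
        mu (snd @^-1` A) = uniform_prob (@ltr01 R) A].

Section iid.
Context (d : measure_display) (T : measurableType d) (R : realType).

Definition cons_tuple_prod n (x : T * n.-tuple T) : n.+1.-tuple T :=
  [tuple of x.1 :: x.2].

Lemma measurable_cons_tuple_prod n :
  measurable_fun [set: T * n.-tuple T] (@cons_tuple_prod n).
Proof.
exact: (measurable_cons (measurable_fst (T2 := n.-tuple T)) measurable_snd).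
Qed.

HB.instance Definition _ n := isMeasurableFun.Build _ _ _ _
  (@cons_tuple_prod n) (@measurable_cons_tuple_prod n).

(* The n-fold product measure, i.e. the joint law of n i.i.d. points of law mu;
   see iid_law_box. *)
Fixpoint iid_law (mu : probability T R) n : probability (n.-tuple T) R :=
  match n with
  | 0 => \d_ [tuple]
  | m.+1 => distribution (mu \x iid_law mu m)%E (@cons_tuple_prod m)
  end.

Lemma iid_law_box (mu : probability T R) n (A : 'I_n -> set T) :
  (forall i, measurable (A i)) ->
  iid_law mu n [set z | forall i, A i (tnth z i)] = (\prod_(i < n) mu (A i))%E.
Proof.
elim: n A => [|n IHn] A mA.
  by rewrite big_ord0 /= diracE mem_set// => -[].
rewrite big_ord_recl -IHn; last by move=> i; exact: mA.
have mB : measurable [set z : n.-tuple T | forall i, A (lift ord0 i) (tnth z i)].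
  rewrite (_ : [set _ | _] =
      \bigcap_i ((tnth (T:=T))^~ i @^-1` A (lift ord0 i))).
    apply: fin_bigcap_measurable => // i _.
    by rewrite -[X in measurable X]setTI; exact: measurable_tnth.
  by apply/seteqP; split => z /= zA i; [move=> _|]; exact: zA.
rewrite -product_measure1E//= /distribution /pushforward; congr (_ _).
apply/seteqP; split => -[x z] /= => [zA|[xA zA] i].
  split; first by have := zA ord0.
  by move=> i; have := zA (lift ord0 i); rewrite tnthS.
by case: (unliftP ord0 i) => [j|] ->//; rewrite tnthS.
Qed.

End iid.

Section perm_of_points.
Context (R : realType) (n : nat).
Implicit Types (z : n.-tuple (plane R)) (s : {perm 'I_n}).

(* 0-based: the point tnth z k has the (xrank z k + 1)-th lowest abscissa. *)
Definition xrank z (k : 'I_n) : nat :=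
  #|[pred l | (tnth z l).1 < (tnth z k).1]|.

Definition yrank z (k : 'I_n) : nat :=
  #|[pred l | (tnth z l).2 < (tnth z k).2]|.

Definition is_perm_of_points z s : Prop :=
  [/\ injective (fun k => (tnth z k).1),
      injective (fun k => (tnth z k).2)
    & forall i k : 'I_n, i = xrank z k :> nat -> s i = yrank z k :> nat].

(* Takes the junk value 1 when two points share a coordinate. *)
Definition Perm z : {perm 'I_n} :=
  odflt 1%g [pick s | `[< is_perm_of_points z s >]].

Definition Sample (mu : probability (plane R) R) (s : {perm 'I_n}) : \bar R :=
  iid_law mu n [set z | Perm z = s].

End perm_of_points.
Arguments Sample {R} n mu s.

Definition LIS n (s : {perm 'I_n}) : nat :=
  \max_(I : {set 'I_n} |
        [forall i in I, forall j in I, (i < j)%N ==> (s i < s j)%N]) #|I|.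

Section LISt.
Context (R : realType).

Definition nondecreasing_set (A : set (R * R)) : Prop :=
  forall a b, A a -> A b -> 0 <= (b.1 - a.1) * (b.2 - a.2).

Definition nondecreasing_union (j : nat) (A : set (R * R)) : Prop :=
  exists B : 'I_j -> set (R * R),
    (forall i, nondecreasing_set (B i)) /\ A = \bigcup_i B i.

Definition LISt (j : nat) (mu : probability (plane R) R) : R :=
  sup [set fine (mu A) | A in [set A : set (R * R) |
         [/\ closed A, A `<=` unit_square R & nondecreasing_union j A]]].

End LISt.

Section Cramer.
Context (R : realType).

(* a log (a / b) for a, b >= 0, with 0 log (0 / b) = 0 and a log (a / 0) = +oo
   for a > 0. *)
Definition xlogxy (a b : R) : \bar R :=
  if a == 0 then 0%E else if b == 0 then +oo%E else (a * ln (a / b))%:E.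

Definition Lambda_star (p q : R) : \bar R :=
  (xlogxy q p + xlogxy (1 - q) (1 - p))%E.

End Cramer.

(* Main.v *)
(* Let A be a closed j-nondecreasing set of mass p and q = j beta. The points of
   a sample that lie in A form j increasing subsequences, so LIS < beta n forces
   fewer than q n of them to lie in A. Their number is binomial (n, p); Chernoff
   bounds the probability by (exp (q t) (1 - p + p exp (-t)))^n for t > 0. Take
   the supremum over A for fixed t first, so that p becomes LISt j mu, and only
   then optimise over t: this avoids any continuity of Lambda_star in p. *)
Require Import Defs.
From mathcomp Require Import all_boot all_order all_algebra all_fingroup.
From mathcomp Require Import all_classical all_reals all_analysis ring.
Import Order.TTheory GRing.Theory Num.Theory.
Import numFieldNormedType.Exports.

Set Implicit Arguments.
Unset Strict Implicit.

Local Open Scope classical_set_scope.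
Local Open Scope ring_scope.

(** * Measure-theoretic preliminaries *)

Lemma measurable_fun_finType d (T : measurableType d) (I : finType) (g : T -> I)
  (P : pred I) :
  (forall i, measurable [set t | g t = i]) -> measurable [set t | P (g t)].
Proof.
move=> mg; rewrite (_ : [set _ | _] = \bigcup_(i in [set` P]) [set t | g t = i]).
  by apply: fin_bigcup_measurable => // i _.
by apply/seteqP; split => [t Pt|t [i /= Pi gti]] /=; [exists (g t)|rewrite gti].
Qed.

Lemma measure_finType d (T : measurableType d) (R : realType)
  (m : {measure set T -> \bar R}) (I : finType) (g : T -> I) (P : pred I) :
  (forall i, measurable [set t | g t = i]) ->
  m [set t | P (g t)] = (\sum_(i | P i) m [set t | g t = i]%classic)%E.
Proof.
move=> mg.
rewrite (_ : [set _ | _] = \bigcup_(i in [set` enum P]) [set t | g t = i]).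
  rewrite measure_fin_bigcup//; last by move=> i j _ _ [t [/= <- <-]].
  by rewrite -fsbig_seq ?enum_uniq// big_enum.
apply/seteqP; split => [t Pt|t [i /= Pi gti]] /=.
  by exists (g t) => //=; rewrite mem_enum.
by move: Pi; rewrite mem_enum gti.
Qed.

(** The index 0 is exempted because the law of [sigma n] is prescribed only for positive [n]. *)
Lemma limn_esup_le (R : realType) (u : (\bar R)^nat) (l : \bar R) :
  (forall n, (0 < n)%N -> (u n <= l)%E) -> (limn_esup u <= l)%E.
Proof.
move=> ul; rewrite /limn_esup /limf_esup.
apply: (@le_trans _ _ (ereal_sup (u @` [set n | (0 < n)%N]))).
  by apply: ereal_inf_lbound; exists [set n | (0 < n)%N] => //; exact: nbhs_infty_ge.
by apply/ereal_supP => _ [n n0 <-]; exact: ul.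
Qed.

(** Links the topology of [R * R] to the product sigma-algebra of [plane R]: an open set is the
    union of the squares with rational centre and radius that it contains, and these are countably
    many. *)
Lemma open_plane_measurable (R : realType) (O : set (R * R)) :
  open O -> measurable (O : set (plane R)).
Proof.
move=> oO.
pose Q (c : (rat * rat) * rat) : set (plane R) :=
  ball (ratr c.1.1 : R) (ratr c.2) `*` ball (ratr c.1.2 : R) (ratr c.2).
rewrite (_ : O = \bigcup_(c in [set c | Q c `<=` O]) Q c).
  rewrite bigcup_mkcond; apply: countable_bigcupT_measurable.
    exact: countableP.
  move=> c; case: ifP => _; last exact: measurable0.
  by apply: measurableX; rewrite ball_itv; exact: measurable_itv.
apply/seteqP; split => [[x y] Oxy|z [c cO Qcz]]; last exact: cO.
have /nbhs_ballP[e /= e0 eO] : nbhs (x, y) O by exact: open_nbhs_nbhs.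
(* A centre within [r] of the point gives a square of radius [r] that contains the point and stays
   within [2 r < e] of it. *)
have [r /itvP re] : exists r : rat, (ratr r : R) \in `]0, e / 2[.
  by apply: rat_in_itvoo; rewrite divr_gt0.
have r0 : 0 < ratr r :> R by rewrite re.
have near_rat (t : R) : exists q : rat, `|ratr q - t| < ratr r.
  have [q /itvP qt] : exists q : rat, (ratr q : R) \in `]t - ratr r, t + ratr r[.
    by apply: rat_in_itvoo; rewrite ltrD2l gtrN.
  by exists q; rewrite ltr_distl !qt.
have [[a ax] [b yb]] := (near_rat x, near_rat y).
exists ((a, b), r); last by split.
have half (c t w : R) : `|c - t| < ratr r -> ball c (ratr r) w -> ball t e w.
  move=> ct; rewrite -!ball_normE /= => cw.
  apply: (@le_lt_trans _ _ (`|c - t| + `|c - w|)); last first.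
    by rewrite (splitr e) ltrD// (lt_trans _ (_ : ratr r < e / 2)) ?re.
  by rewrite (distrC c t) (le_trans _ (ler_normD _ _))// addrA subrK.
by move=> [u v] [/= ua vb]; apply: eO; split => /=; [exact: half ua|exact: half vb].
Qed.

Lemma closed_plane_measurable (R : realType) (A : set (R * R)) :
  closed A -> measurable (A : set (plane R)).
Proof.
by move=> /closed_openC /open_plane_measurable /measurableC; rewrite setCK.
Qed.

(** * Ranks, measurability of [Perm], and increasing subsequences from nondecreasing sets *)

Section rank.
Context (R : realType) (n : nat) (f : 'I_n -> R).

Let rank k := #|[pred l | f l < f k]|.

Lemma rank_lt k l : f k < f l -> (rank k < rank l)%N.
Proof.
move=> fkl; apply: proper_card; apply/properP; split.
  by apply/fintype.subsetP => i; rewrite !inE => /lt_trans; apply.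
by exists k; rewrite !inE ?fkl// ltxx.
Qed.

Lemma rank_ltV k l : (rank k < rank l)%N -> f k < f l.
Proof.
apply: contraTT; rewrite -leNgt -leqNgt => flk; apply: subset_leq_card.
by apply/fintype.subsetP => i; rewrite !inE => /lt_le_trans; apply.
Qed.

Lemma rank_ltn k : (rank k < n)%N.
Proof.
rewrite -[n in (_ < n)%N]card_ord; apply: proper_card; apply/properP; split.
  exact/fintype.subsetP.
by exists k; rewrite // inE ltxx.
Qed.

End rank.

Section perm_of_points_facts.
Context (R : realType) (n : nat).
Implicit Types (z : n.-tuple (plane R)) (s : {perm 'I_n}).

(** This finite pattern determines [Perm z], so measurability of the fibres of [Perm] reduces to
    that of events comparing two coordinates. *)
Definition comparisons z : {ffun 'I_n * 'I_n -> bool * bool} :=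
  [ffun kl => ((tnth z kl.1).1 < (tnth z kl.2).1,
               (tnth z kl.1).2 < (tnth z kl.2).2)].

Lemma is_perm_of_points_comparisons z z' s : comparisons z = comparisons z' ->
  is_perm_of_points z s -> is_perm_of_points z' s.
Proof.
move=> /ffunP czz'.
have cx k l : ((tnth z k).1 < (tnth z l).1) = ((tnth z' k).1 < (tnth z' l).1).
  by have := czz' (k, l); rewrite !ffunE => -[].
have cy k l : ((tnth z k).2 < (tnth z l).2) = ((tnth z' k).2 < (tnth z' l).2).
  by have := czz' (k, l); rewrite !ffunE => -[].
move=> [xi yi sxy]; split => [k l e|k l e|i k].
- by apply: xi; apply/eqP; rewrite eq_le !leNgt !cx e ltxx.
- by apply: yi; apply/eqP; rewrite eq_le !leNgt !cy e ltxx.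
- have -> : xrank z' k = xrank z k by apply: eq_card => l; rewrite !inE cx.
  have -> : yrank z' k = yrank z k by apply: eq_card => l; rewrite !inE cy.
  exact: sxy.
Qed.

Lemma Perm_comparisons z z' : comparisons z = comparisons z' -> Defs.Perm z = Defs.Perm z'.
Proof.
move=> e; rewrite /Defs.Perm; congr odflt; apply: eq_pick => s.
by apply/asboolP/asboolP; apply: is_perm_of_points_comparisons.
Qed.

Lemma measurable_comparisons c :
  measurable [set z : n.-tuple (plane R) | comparisons z = c].
Proof.
pose X k z : R := (tnth z k).1; pose Y k z : R := (tnth z k).2.
have mX k : measurable_fun setT (X k).
  apply: (@measurableT_comp _ _ _ _ _ _ fst); first exact: measurable_fst.
  exact: measurable_tnth.
have mY k : measurable_fun setT (Y k).
  apply: (@measurableT_comp _ _ _ _ _ _ snd); first exact: measurable_snd.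
  exact: measurable_tnth.
have mlt (f g : n.-tuple (plane R) -> R) b : measurable_fun setT f ->
    measurable_fun setT g -> measurable [set z | (f z < g z) = b].
  move=> mf mg; rewrite -[X in measurable X]setTI.
  by have /(_ [set b]) := measurable_realfun.measurable_fun_ltr mf mg measurableT; apply.
rewrite (_ : [set _ | _] = \bigcap_(kl : 'I_n * 'I_n)
    ([set z | (X kl.1 z < X kl.2 z) = (c kl).1] `&`
     [set z | (Y kl.1 z < Y kl.2 z) = (c kl).2])).
  by apply: fin_bigcap_measurable => // kl _; apply: measurableI; exact: mlt.
apply/seteqP; split => [z <- kl _|z zc]; first by rewrite /= ffunE.
apply/ffunP => kl; rewrite ffunE.
by have [] := zc kl I; rewrite /X /Y /= => -> ->; case: (c kl).
Qed.

Lemma measurable_Perm s : measurable [set z : n.-tuple (plane R) | Defs.Perm z = s].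
Proof.
have /(@measurable_fun_finType _ _ _ (@comparisons)
  (fun c => `[< exists2 z', comparisons z' = c & Defs.Perm z' = s >])) :=
  measurable_comparisons.
congr measurable; apply/seteqP; split => z /=.
  by move=> /asboolP[z' /Perm_comparisons ->].
by move=> zs; apply/asboolP; exists z.
Qed.

Lemma leq_LIS1 : (n <= LIS (1%g : {perm 'I_n}))%N.
Proof.
rewrite -{1}(card_ord n) -cardsT /LIS; apply: leq_bigmax_cond.
by apply/forall_inP => i _; apply/forall_inP => j _; rewrite !perm1 implybb.
Qed.

(* When Perm takes its junk value 1, the LIS is n. *)
Lemma is_perm_of_points_Perm z :
  (LIS (Defs.Perm z) < n)%N -> is_perm_of_points z (Defs.Perm z).
Proof.
rewrite /Defs.Perm; case: pickP => [s /asboolP//|_ /=].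
by rewrite ltnNge leq_LIS1.
Qed.

(** Recording the indices rather than their number makes each fibre a box of the product space, so
    its law is a plain product without binomial coefficients. *)
Definition hits (A : set (plane R)) z : {set 'I_n} :=
  [set k | `[< A (tnth z k) >]].

(** Read from left to right, the points in [B] have strictly increasing ordinates, so their
    positions in [s] carry an increasing subsequence. *)
Lemma card_hits_nondecreasing z s (B : set (R * R)) :
  is_perm_of_points z s -> nondecreasing_set B -> (#|hits B z| <= LIS s)%N.
Proof.
move=> [xi yi sxy] ndB.
pose X k : R := (tnth z k).1; pose Y k : R := (tnth z k).2.
(* Turns the index of a point in the sample into its position in the permutation. *)
pose xr k : 'I_n := Ordinal (rank_ltn X k).
have xr_inj : injective xr.
  move=> k l /(congr1 val) /= e; apply: xi; apply/eqP.
  by rewrite eq_le !leNgt; apply/andP; split; apply/negP;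
    move=> /(rank_lt (f := X)); rewrite e ltnn.
rewrite -(card_imset _ xr_inj) /LIS; apply: leq_bigmax_cond.
apply/forall_inP => _ /imsetP[k + ->]; rewrite inE => /asboolP Bk.
apply/forall_inP => _ /imsetP[l + ->]; rewrite inE => /asboolP Bl.
apply/implyP => /(rank_ltV (f := X)) xkl.
rewrite (sxy (xr k) k erefl) (sxy (xr l) l erefl).
apply: (rank_lt (f := Y)).
(* Nondecreasing gives only a weak inequality between ordinates; equality is excluded because the
   ordinates are distinct. *)
have := ndB _ _ Bk Bl; rewrite pmulr_rge0 ?subr_gt0// subr_ge0 le_eqVlt.
by case/predU1P => // /yi kl; move: xkl; rewrite kl ltxx.
Qed.

Lemma card_hits_nondecreasing_union z s j (A : set (R * R)) :
  is_perm_of_points z s -> nondecreasing_union j A ->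
  (#|hits A z| <= j * LIS s)%N.
Proof.
move=> zs [B [ndB ->]].
have -> : hits (\bigcup_i B i) z = (\bigcup_i hits (B i) z)%SET.
  apply/setP => k; rewrite inE; apply/asboolP/finset.bigcupP.
    by move=> [i _ Bik]; exists i; rewrite // inE; apply/asboolP.
  by move=> [i _]; rewrite inE => /asboolP; exists i.
apply: (@leq_trans (\sum_i #|hits (B i) z|)%N).
  elim/big_ind2 : _ => [|S a T b Sa Tb|//]; first by rewrite cards0.
  by rewrite (leq_trans _ (leq_add Sa Tb))// cardsU leq_subr.
rewrite -[j in (j * _)%N]card_ord -sum_nat_const; apply: leq_sum => i _.
exact: card_hits_nondecreasing.
Qed.

End perm_of_points_facts.

(** * Chernoff bound for the number of sample points in a fixed set *)

Section binomial_tail.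
Context (R : realType) (mu : probability (plane R) R).
Variables (A : set (plane R)) (mA : measurable A).

Let p := fine (mu A).

Lemma measurable_hits n (S : {set 'I_n}) : measurable [set z | hits A z = S].
Proof.
rewrite (_ : [set _ | _] = \bigcap_k
    ((tnth (T := plane R))^~ k @^-1` (if k \in S then A else ~` A))).
  apply: fin_bigcap_measurable => // k _; rewrite -[X in measurable X]setTI.
  by apply: measurable_tnth => //; case: ifP => _ //; exact: measurableC.
apply/seteqP; split => [z <- k _ /=|z zS].
  by rewrite inE; case: asboolP.
apply/setP => k; have := zS k Logic.I; rewrite /= inE.
by case: (k \in S); case: asboolP.
Qed.

Lemma iid_law_hits n (S : {set 'I_n}) :
  iid_law mu n [set z | hits A z = S] =
  (\prod_(k < n) (if k \in S then p else 1 - p))%:E.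
Proof.
have pE : mu A = p%:E by rewrite fineK// fin_num_measure.
pose B k := if k \in S then A else ~` A.
have mB k : measurable (B k) by rewrite /B; case: ifP => // _; exact: measurableC.
rewrite (_ : [set _ | _] = [set z | forall k, B k (tnth z k)]).
  rewrite iid_law_box// -prodEFin; apply: eq_bigr => k _; rewrite /B.
  by case: ifP => _ //; rewrite probability_setC// pE.
apply/seteqP; split => [z /= hz k|z zS].
  by rewrite /B -hz inE; case: asboolP.
apply/setP => k; have := zS k; rewrite /B inE.
by case: (k \in S); case: asboolP.
Qed.

(* Markov's inequality for [expR (- t * #|hits A z|)]. *)
Lemma iid_law_card_hits_lt n (q t : R) : 0 <= t ->
  (iid_law mu n [set z | #|hits A z|%:R < q * n%:R]%R <=
   ((expR (q * t) * (1 - p + p * expR (- t))) ^+ n)%:E)%E.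
Proof.
move=> t0.
have mu01 : (0 <= mu A <= 1)%E by rewrite measure_ge0 probability_le1.
have [p0 p1] : 0 <= p /\ p <= 1.
  have pE : mu A = p%:E by rewrite fineK// fin_num_measure.
  by move: mu01; rewrite pE !lee_fin => /andP[].
pose w (S : {set 'I_n}) := \prod_(k < n) (if k \in S then p else 1 - p).
have w0 S : 0 <= w S by apply: prodr_ge0 => k _; case: ifP; rewrite ?subr_ge0.
rewrite (measure_finType _ (fun S : {set 'I_n} => #|S|%:R < q * n%:R)); last first.
  exact: measurable_hits.
rewrite (eq_bigr _ (fun S _ => iid_law_hits S)).
rewrite sumEFin lee_fin exprMn.
(* The power is the Laplace transform of the number of hits, written as a sum over all possible hit
   sets [S]; below, it comes from expanding a product of [n] binomials. *)
rewrite (_ : (_ - _ + _) ^+ n = \sum_(S : {set 'I_n}) expR (- t) ^+ #|S| * w S).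
  rewrite mulr_sumr big_mkcond /=; apply: ler_sum => S _.
  case: ifPn => [Sq|_]; last by rewrite !mulr_ge0 ?exprn_ge0 ?expR_ge0.
  (* When [#|S| < q n], the factor in front of [w S] is the exponential of [t (q n - #|S|)], hence
     at least 1. *)
  rewrite mulrA ler_peMl ?w0// -!expRM_natl -expRD -[leLHS]expR0 ler_expR.
  rewrite (_ : _ + _ = t * (q * n%:R - #|S|%:R)); last by ring.
  by rewrite mulr_ge0// subr_ge0 ltW.
rewrite (_ : _ ^+ n = \prod_(k < n) (p * expR (- t) + (1 - p))); last first.
  by rewrite prodr_const card_ord addrC.
rewrite bigA_distr; apply: eq_bigr => S _.
rewrite -prodr_const [X in _ = X * _]big_mkcond -big_split; apply: eq_bigr => k _ /=.
by case: ifP => _; rewrite ?mul1r// mulrC.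
Qed.

End binomial_tail.

(** * Bounds on [LISt], and passage from a short LIS to few hits *)

Section LISt_facts.
Context (R : realType) (mu : probability (plane R) R).

(** With the empty set as a member ([LISt_set0]), this makes the real [sup] in [LISt] a genuine
    supremum. *)
Lemma LISt_ubound j :
  ubound [set fine (mu A) | A in [set A : set (R * R) |
    [/\ closed A, A `<=` unit_square R & nondecreasing_union j A]]] 1.
Proof.
move=> _ [A [cA _ _] <-].
have mA : measurable (A : set (plane R)) by exact: closed_plane_measurable.
by rewrite -lee_fin fineK ?fin_num_measure// probability_le1.
Qed.

Lemma nondecreasing_union_set0 j : nondecreasing_union j (set0 : set (R * R)).
Proof. by exists (fun=> set0); split=> [i ? ? []|]; rewrite bigcup0. Qed.

Lemma LISt_set0 j :
  [set fine (mu A) | A in [set A : set (R * R) |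
    [/\ closed A, A `<=` unit_square R & nondecreasing_union j A]]] 0.
Proof.
exists set0; last by rewrite measure0.
by split; [exact: closed0|exact: sub0set|exact: nondecreasing_union_set0].
Qed.

Lemma LISt_le1 j : LISt j mu <= 1.
Proof. by apply: ge_sup; [exists 0; exact: LISt_set0|exact: LISt_ubound]. Qed.

End LISt_facts.

Lemma Sample_le_hits (R : realType) (mu : probability (plane R) R) n j
  (A : set (R * R)) (beta : R) : (0 < n)%N -> (0 < j)%N -> beta <= 1 ->
  measurable (A : set (plane R)) -> nondecreasing_union j A ->
  (\sum_(s : {perm 'I_n} | ((LIS s)%:R < beta * n%:R)%R) Sample n mu s <=
   iid_law mu n [set z | (#|hits A z|%:R < j%:R * beta * n%:R)%R])%E.
Proof.
move=> n0 j0 beta1 mA ndA; rewrite /Sample.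
rewrite -(measure_finType _ (fun s : {perm 'I_n} => (LIS s)%:R < beta * n%:R)); last first.
  exact: measurable_Perm.
apply: le_measure; rewrite ?inE.
- apply: (measurable_fun_finType (fun s : {perm 'I_n} => (LIS s)%:R < beta * n%:R)).
  exact: measurable_Perm.
- apply: (measurable_fun_finType (fun S : {set 'I_n} => #|S|%:R < j%:R * beta * n%:R)).
  exact: measurable_hits.
move=> z /= zlt.
(* Here [beta <= 1] matters: it excludes the junk value 1 of [Perm], whose LIS is [n], so the points
   have distinct coordinates. *)
have LISn : (LIS (Defs.Perm z) < n)%N.
  by rewrite -(ltr_nat R) (lt_le_trans zlt)// ler_piMl.
apply: (@le_lt_trans _ _ (j%:R * (LIS (Defs.Perm z))%:R)).
  rewrite -natrM ler_nat; apply: card_hits_nondecreasing_union ndA.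
  exact: is_perm_of_points_Perm.
by rewrite -mulrA ltr_pM2l// ltr0n.
Qed.

(** * Optimisation of the exponent and conclusion *)

Lemma interp_expRN_gt0 (R : realType) (p t : R) : 0 <= p <= 1 ->
  0 < 1 - p + p * expR (- t).
Proof.
move=> /andP[p0 p1]; have e0 := expR_gt0 (- t).
have [->|pn1] := eqVneq p 1; first by rewrite subrr add0r mul1r.
by rewrite ltr_wpDr ?mulr_ge0 ?(ltW e0)// subr_gt0 lt_neqAle pn1.
Qed.

(* Optimises the Chernoff exponent over [t > 0]. *)
Lemma Lambda_star_le (R : realType) (P q : R) (L : \bar R) :
  0 < q -> q < P -> P <= 1 ->
  (forall t, 0 < t -> (L <= (q * t + ln (1 - P + P * expR (- t)))%:E)%E) ->
  (Lambda_star P q <= - L)%E.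
Proof.
move=> q0 qP P1 HL; have P0 : 0 < P by exact: lt_trans qP.
have q1 : 0 < 1 - q by rewrite subr_gt0 (lt_le_trans qP).
rewrite /Lambda_star /xlogxy (gt_eqF q0) (gt_eqF P0) (gt_eqF q1).
have [P1e|P1n] := eqVneq (1 - P) 0.
  (* If [P = 1], then [Lambda_star] is infinite and the exponent is [- (1 - q) t], unbounded below.
     For finite [l], the [t] chosen below makes it [- (|l| + 1) < l]. *)
  rewrite addey//; case: L HL => [l|/(_ 1 ltr01)//|//] HL; exfalso.
  have PE : P = 1 by apply/eqP; rewrite eq_sym -subr_eq0 P1e.
  have t0 : 0 < (`|l| + 1) / (1 - q) by rewrite divr_gt0// ltr_wpDl.
  have := HL _ t0; rewrite P1e add0r PE mul1r expRK lee_fin leNgt => /negP; apply.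
  rewrite (_ : _ + _ = - (`|l| + 1)); last by field; rewrite gt_eqF.
  by rewrite ltrNl (le_lt_trans (ler_norm _))// normrN ltrDl.
have P1' : 0 < 1 - P by rewrite lt_neqAle eq_sym P1n subr_ge0.
(* The critical point of the exponent, where [expR (- t) = q (1 - P) / (P (1 - q))]. Both logarithms
   are positive since [q < P], and the exponent there equals [- Lambda_star P q]. *)
pose t := ln (q^-1 * P) + ln ((1 - P)^-1 * (1 - q)).
have t0 : 0 < t.
  by apply: addr_gt0; apply: ln_gt0; rewrite ltr_pdivlMl ?mulr1// ltrD2l ltrN2.
rewrite leeNr (le_trans (HL t t0))// -EFinD -EFinN lee_fin.
have eE : expR (- t) = (q / P) * ((1 - P) / (1 - q)).
  rewrite expRN expRD !lnK ?posrE ?mulr_gt0 ?invr_gt0//.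
  by field; rewrite !gt_eqF.
have -> : 1 - P + P * expR (- t) = (1 - P) / (1 - q).
  by rewrite eE; field; rewrite !gt_eqF.
rewrite /t [q^-1 * P]mulrC [_^-1 * (1 - q)]mulrC.
rewrite !ln_div ?posrE//.
by rewrite le_eqVlt; apply/orP; left; apply/eqP; ring.
Qed.

Theorem proposition2p6 (R : realType) (mu : probability (plane R) R)
  (hmu : permuton mu)
  (d : nat -> measure_display) (Omega : forall n, measurableType (d n))
  (P : forall n, probability (Omega n) R)
  (sigma : forall n, Omega n -> {perm 'I_n})
  (sigma_meas : forall n, (0 < n)%N -> forall s : {perm 'I_n},
     measurable [set w | sigma n w = s])
  (sigma_law : forall n, (0 < n)%N -> forall s : {perm 'I_n},
     P n [set w | sigma n w = s] = Sample n mu s)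
  (beta : R) (beta_gt0 : 0 < beta) (beta_lt : beta < LISt 1 mu) :
  (limn_esup (fun n => (n%:R^-1)%:E *
       lne (P n [set w | ((LIS (sigma n w))%:R < beta * n%:R)%R]))
   <= - ereal_sup [set Lambda_star (LISt j mu) (j%:R * beta)%R |
        j in [set j : nat | (1 <= j)%N /\ (j%:R * beta < LISt j mu)%R]])%E.
Proof.
rewrite leeNr; apply: ge_ereal_sup => _ [j [j1 jb] <-].
have beta1 : beta <= 1 by rewrite (le_trans (ltW beta_lt))// LISt_le1.
apply: Lambda_star_le => //; first by rewrite mulr_gt0// ltr0n.
  exact: LISt_le1.
move=> t t0; set L := limn_esup _.
(* The Chernoff bound at fixed [t], stated for every mass [r] of an admissible set; [LISt j mu]
   itself need not be such a mass. *)
have LA r : [set fine (mu A) | A in [set A : set (R * R) |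
      [/\ closed A, A `<=` unit_square R & nondecreasing_union j A]]] r ->
    0 <= r <= 1 /\
    (L <= (j%:R * beta * t + ln (1 - r + r * expR (- t)))%:E)%E.
  move=> Ar; have r1 := LISt_ubound Ar.
  have [A [cA _ ndA] rE] := Ar.
  have r01 : 0 <= r <= 1 by rewrite r1 andbT -rE fine_ge0.
  split => //; apply: limn_esup_le => n n0.
  have mA : measurable (A : set (plane R)) by exact: closed_plane_measurable.
  set K := expR (j%:R * beta * t) * (1 - r + r * expR (- t)).
  have K0 : 0 < K by rewrite mulr_gt0 ?expR_gt0// interp_expRN_gt0.
  have PK : (P n [set w | ((LIS (sigma n w))%:R < beta * n%:R)%R] <= (K ^+ n)%:E)%E.
    rewrite (measure_finType _ (fun s : {perm 'I_n} => (LIS s)%:R < beta * n%:R)); last first.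
      exact: (sigma_meas n n0).
    rewrite (eq_bigr _ (fun s _ => sigma_law n n0 s)).
    rewrite (le_trans (Sample_le_hits mu n0 j1 beta1 mA ndA))//.
    by rewrite /K -rE; apply: iid_law_card_hits_lt => //; exact: ltW.
  have lneK : (lne (P n [set w | ((LIS (sigma n w))%:R < beta * n%:R)%R]) <=
      (n%:R * ln K)%:E)%E.
    rewrite mulr_natl -lnXn// -lne_EFin ?exprn_gt0// lee_lne//.
      by rewrite in_itv /= measure_ge0 leey.
    by rewrite in_itv /= leey lee_fin exprn_ge0// ltW.
  apply: (@le_trans _ _ ((n%:R^-1)%:E * (n%:R * ln K)%:E)%E).
    by rewrite lee_pmul2l// lte_fin invr_gt0 ltr0n.
  rewrite -EFinM mulKf ?pnatr_eq0 -?lt0n// /K lnM ?posrE ?expR_gt0//.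
    by rewrite expRK.
  exact: interp_expRN_gt0.
(* The empty set, of mass 0, gives a finite upper bound that excludes [L = +oo]; the case [L = -oo]
   is trivial. *)
have [_ L0] := LA _ (LISt_set0 mu j).
move: LA L0; case: L => [l| |] LA L0 //; last by rewrite leNye.
have D0 : 0 < 1 - expR (- t) by rewrite subr_gt0 -expR0 ltr_expR oppr_lt0.
set E := expR (l - j%:R * beta * t).
(* Since [1 - r + r * expR (- t)] is affine and decreasing in [r], the bound on [l] becomes an upper
   bound on [r] that is the same for all admissible sets. It therefore passes to the supremum, and
   the equivalence is then read backwards at [r = LISt j mu]. *)
have lE r : 0 <= r <= 1 ->
    (l <= j%:R * beta * t + ln (1 - r + r * expR (- t))) =
    (r <= (1 - E) / (1 - expR (- t))).
  move=> r01; rewrite -lerBlDl -ler_expR lnK ?posrE ?interp_expRN_gt0//.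
  rewrite ler_pdivlMr// lerBrDl -lerBrDr -/E.
  by congr (E <= _); ring.
have LP : LISt j mu <= (1 - E) / (1 - expR (- t)).
  apply: ge_sup; first by exists 0; exact: LISt_set0.
  by move=> r /LA[r01]; rewrite lee_fin lE.
rewrite lee_fin lE// LISt_le1 andbT (le_trans _ (ltW jb))//.
by rewrite mulr_ge0// ltW.
Qed.
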